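(* Let $\mathcal{E}$ be a locally cartesian closed category, let $\mathbf{Poly}_c(\mathcal{E})$ be the bicategory of polynomials in $\mathcal{E}$ with cartesian 2-cells, and let $\mathscr{C}$ be a bicategory. Then to give an oplax functor $L\colon\mathbf{Poly}_c(\mathcal{E})\to\mathscr{C}$ is to give a locally defined functor $$L_{X,Y}\colon\mathbf{Poly}_c(\mathcal{E})_{X,Y}\to\mathscr{C}_{LX,LY},\qquad X,Y\in\mathcal{E},$$ together with 2-cells $$\Phi_{s,p_1,h,p_2,t}\colon L(s,p,t)\to L(s,p_1,h);L(h,p_2,t),\qquad\Lambda_h\colon L(h,1,h)\to1_{LX},$$ the former for all morphisms $s\colon E\to X$, $p_1\colon E\to T$, $h\colon T\to Y$, $p_2\colon T\to B$, $t\colon B\to Z$ in $\mathcal{E}$, where $p=p_1;p_2\colon E\to B$, and the latter for every morphism $h\colon T\to X$ in $\mathcal{E}$, such that: (1) for all $u\colon R\to X$, $q_1\colon R\to S$, $k\colon S\to Y$, $q_2\colon S\to I$, $v\colon I\to Z$ with $q=q_1;q_2$, all $s\colon E\to X$, $p_1\colon E\to T$, $h\colon T\to Y$, $p_2\colon T\to B$, $t\colon B\to Z$ with $p=p_1;p_2$, and all $f\colon R\to E$, $c\colon S\to T$, $g\colon I\to B$ such that $(f,g)\colon(u,q,v)\to(s,p,t)$, $(f,c)\colon(u,q_1,k)\to(s,p_1,h)$ and $(c,g)\colon(k,q_2,v)\to(h,p_2,t)$ are morphisms of polynomials (cartesian 2-cells), one has $$\Phi_{s,p_1,h,p_2,t}\circ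 L(f,g)=\bigl(L(f,c);L(c,g)\bigr)\circ\Phi_{u,q_1,k,q_2,v};$$ (2) for all $s\colon R\to X$, $t\colon T\to X$ and $f\colon R\to T$ with $tf=s$ (so that $(f,f)\colon(s,1,s)\to(t,1,t)$ is a morphism of polynomials), one has $\Lambda_t\circ L(f,f)=\Lambda_s$; (3) for all morphisms $s\colon F\to W$, $a\colon F\to G$, $h\colon G\to X$, $b\colon G\to H$, $k\colon H\to Y$, $c\colon H\to K$, $t\colon K\to Z$ in $\mathcal{E}$ one has $$\mathrm{assoc}\circ\bigl(L(s,a,h);\Phi_{h,b,k,c,t}\bigr)\circ\Phi_{s,a,h,b;c,t}=\bigl(\Phi_{s,a,h,b,k};L(k,c,t)\bigr)\circ\Phi_{s,a;b,k,c,t}$$ as 2-cells $L(s,a;b;c,t)\to\bigl(L(s,a,h);L(h,b,k)\bigr);L(k,c,t)$; (4) for every polynomial $(s,p,t)$ from $X$ to $Y$, the composite $\bigl(\Lambda_s;L(s,p,t)\bigr)\circ\Phi_{s,1,s,p,t}$ is the unitor $L(s,p,t)\to1_{LX};L(s,p,t)$ and the composite $\bigl(L(s,p,t);\Lambda_t\bigr)\circ\Phi_{s,p,t,1,t}$ is the unitor $L(s,p,t)\to L(s,p,t);1_{LY}$.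
   Context: **Polynomials.** $\mathbf{Poly}_c(\mathcal{E})$ (Gambino–Kock, Weber) has the objects of $\mathcal{E}$; a 1-cell $X\to Z$ is a polynomial $X\xleftarrow{s}E\xrightarrow{p}B\xrightarrow{t}Z$ in $\mathcal{E}$, written $(s,p,t)$. A 2-cell (cartesian morphism of polynomials) $(a,i,b)\to(u,j,v)$ from $X\xleftarrow{a}K\xrightarrow{i}I\xrightarrow{b}Y$ to $X\xleftarrow{u}R\xrightarrow{j}J\xrightarrow{v}Y$ is a pair $(f,g)$, $f\colon K\to R$, $g\colon I\to J$, with $uf=a$, $vg=b$, $jf=gi$ and the square $jf=gi$ a pullback. Identity 1-cells are $(1,1,1)$. The composite of $X\xleftarrow{s}E\xrightarrow{p}B\xrightarrow{t}Y$ with $Y\xleftarrow{u}F\xrightarrow{q}C\xrightarrow{v}Z$ is the usual one, representing the composite of the functors $\Sigma_t\Pi_p\Delta_s\colon\mathcal{E}/X\to\mathcal{E}/Y$ and $\Sigma_v\Pi_q\Delta_u\colon\mathcal{E}/Y\to\mathcal{E}/Z$: let $D\to C$ be $\Pi_q$ applied to the projection $B\times_YF\to F$ (pullback of $t$ and $u$), let $F\times_CD\to B\times_YF$ be the counit over $F$, and let $N=E\times_B(F\times_CD)$; the composite is $X\leftarrow E\leftarrow N\to F\times_CD\to D\to C\to Z$, with middle map $N\to F\times_CD\to D$. **Conventions.** Composition in bicategories, and of morphisms in $\mathcal{E}$ when written with ''$;$'', is in diagrammatic order (for $a\colon X\to Y$, $b\colon Y\to Z$ the composite is $a;b\colon X\to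 Z$); ''$;$'' also denotes horizontal composition of 2-cells; a 1-cell in a horizontal composite of 2-cells stands for its identity 2-cell; $\circ$ is vertical composition. $\mathscr{A}_{X,Y}$ denotes a hom-category of a bicategory $\mathscr{A}$. ''assoc'' and ''unitor'' denote the appropriate components of the associativity and unit constraints of $\mathscr{C}$ (or their inverses). A locally defined functor is an assignment $X\mapsto LX$ on objects together with functors $L_{X,Y}$ on hom-categories. An oplax functor is a locally defined functor with 2-cells $L(a;b)\to La;Lb$ natural in $a,b$ and $L1_X\to1_{LX}$ satisfying the usual associativity and unit axioms. ''To give … is to give …'' means that, for a fixed locally defined functor $L$, the two kinds of structure are in bijection. *)

(* Defs.v *)
From mathcomp Require Import ssreflect ssrfun ssrbool.
From Stdlib Require Import ProofIrrelevance IndefiniteDescription.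

Set Implicit Arguments.
Unset Strict Implicit.
Unset Printing Implicit Defensive.

Declare Scope cat_scope.
Delimit Scope cat_scope with cat.
Local Open Scope cat_scope.

Record Category := {
  ob :> Type;
  hom : ob -> ob -> Type;
  idm : forall a, hom a a;
  comp : forall a b c, hom a b -> hom b c -> hom a c;
  comp1m : forall a b (f : hom a b), comp (idm a) f = f;
  compm1 : forall a b (f : hom a b), comp f (idm b) = f;
  compA : forall a b c d (f : hom a b) (g : hom b c) (h : hom c d),
    comp f (comp g h) = comp (comp f g) h }.

Arguments idm {_} _.
Arguments comp {_ _ _ _} _ _.

(* [f ;; g] is in diagrammatic order, [g ∘ f] is the same morphism in
   applicative order (used for the vertical composition of 2-cells). *)
Notation "f ;; g" := (comp f g) (at level 50, left associativity) : cat_scope.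
Notation "g ∘ f" := (comp f g) (at level 40, left associativity, only parsing) : cat_scope.

Record Functor (C D : Category) := {
  fob :> C -> D;
  fmap : forall a b : C, hom a b -> hom (fob a) (fob b);
  fmap1 : forall a, fmap (idm a) = idm (fob a);
  fmapM : forall a b c (f : hom a b) (g : hom b c), fmap (f ;; g) = fmap f ;; fmap g }.

Arguments fmap {C D} _ {a b} _.

(* A right adjoint of [F], given by a couniversal arrow to each object. *)
Record RightAdjoint (C D : Category) (F : Functor C D) := {
  radj : D -> C;
  counit : forall d, hom (F (radj d)) d;
  radj_univ : forall c d (u : hom (F c) d), exists! k : hom c (radj d),
    fmap F k ;; counit d = u }.

Arguments radj {C D F} _ _.
Arguments counit {C D F} _ _.

Definition is_pullback (E : Category) (P A B C : E)
    (p1 : hom P A) (p2 : hom P B) (f : hom A C) (g : hom B C) : Prop :=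
  p1 ;; f = p2 ;; g /\
  forall W (x : hom W A) (y : hom W B), x ;; f = y ;; g ->
    exists! w : hom W P, w ;; p1 = x /\ w ;; p2 = y.

Record Pullbacks (E : Category) := {
  pb : forall A B C : E, hom A C -> hom B C -> E;
  pb1 : forall A B C (f : hom A C) (g : hom B C), hom (pb f g) A;
  pb2 : forall A B C (f : hom A C) (g : hom B C), hom (pb f g) B;
  pbP : forall A B C (f : hom A C) (g : hom B C), is_pullback (pb1 f g) (pb2 f g) f g }.

Arguments pb {E} _ {A B C} _ _.
Arguments pb1 {E} _ {A B C} _ _.
Arguments pb2 {E} _ {A B C} _ _.
Arguments pbP {E} _ {A B C} _ _.

Section PullbackTheory.
Context {E : Category}.

Lemma lift_sig (P A B C : E) (p1 : hom P A) (p2 : hom P B) (f : hom A C) (g : hom B C)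
    (H : is_pullback p1 p2 f g) W (x : hom W A) (y : hom W B) (e : x ;; f = y ;; g) :
  {w : hom W P | w ;; p1 = x /\ w ;; p2 = y}.
Proof.
apply: constructive_indefinite_description.
by case: H => _ /(_ W x y e) [w [Hw _]]; exists w.
Qed.

Definition lift (P A B C : E) (p1 : hom P A) (p2 : hom P B) (f : hom A C) (g : hom B C)
    (H : is_pullback p1 p2 f g) W (x : hom W A) (y : hom W B) (e : x ;; f = y ;; g) :
  hom W P := proj1_sig (lift_sig H e).

Lemma lift1 (P A B C : E) (p1 : hom P A) (p2 : hom P B) (f : hom A C) (g : hom B C)
    (H : is_pullback p1 p2 f g) W (x : hom W A) (y : hom W B) (e : x ;; f = y ;; g) :
  lift H e ;; p1 = x.
Proof. by rewrite /lift; case: lift_sig => w []. Qed.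

Lemma lift2 (P A B C : E) (p1 : hom P A) (p2 : hom P B) (f : hom A C) (g : hom B C)
    (H : is_pullback p1 p2 f g) W (x : hom W A) (y : hom W B) (e : x ;; f = y ;; g) :
  lift H e ;; p2 = y.
Proof. by rewrite /lift; case: lift_sig => w []. Qed.

Lemma pb_ext (P A B C : E) (p1 : hom P A) (p2 : hom P B) (f : hom A C) (g : hom B C)
    (H : is_pullback p1 p2 f g) W (w w' : hom W P) :
  w ;; p1 = w' ;; p1 -> w ;; p2 = w' ;; p2 -> w = w'.
Proof.
move=> e1 e2; case: (H) => sq /(_ W (w ;; p1) (w ;; p2)).
case; first by rewrite -!compA sq.
by move=> z [_ Hz]; rewrite -(Hz w) // -(Hz w') // e1 e2.
Qed.

Lemma pullback_intro (P A B C : E) (p1 : hom P A) (p2 : hom P B) (f : hom A C) (g : hom B C) :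
  p1 ;; f = p2 ;; g ->
  (forall W (x : hom W A) (y : hom W B), x ;; f = y ;; g ->
     exists w : hom W P, w ;; p1 = x /\ w ;; p2 = y) ->
  (forall W (w w' : hom W P), w ;; p1 = w' ;; p1 -> w ;; p2 = w' ;; p2 -> w = w') ->
  is_pullback p1 p2 f g.
Proof.
move=> sq ex un; split=> // W x y e; case: (ex W x y e) => w [e1 e2].
exists w; split=> // w' [e1' e2']; apply: un; congruence.
Qed.

(* The squares are drawn with [f, c, g] going from the top row to the bottom row:
   K --p1--> T --p2--> I  over  R --q1--> S --q2--> J. *)
Lemma pullback_paste (K T I R S J : E) (p1 : hom K T) (p2 : hom T I)
    (q1 : hom R S) (q2 : hom S J) (f : hom K R) (c : hom T S) (g : hom I J) :
  is_pullback f p1 q1 c -> is_pullback c p2 q2 g -> is_pullback f (p1 ;; p2) (q1 ;; q2) g.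
Proof.
move=> H1 H2; apply: pullback_intro.
- by rewrite compA (proj1 H1) -compA (proj1 H2) compA.
- move=> W x y; rewrite compA => e.
  have e' : x ;; q1 = lift H2 e ;; c by rewrite lift1.
  by exists (lift H1 e'); rewrite compA lift1 !lift2.
move=> W w w' e1 e2; apply: (pb_ext H1) => //; apply: (pb_ext H2).
- by rewrite -!compA -(proj1 H1) !compA e1.
by rewrite -!compA.
Qed.

Lemma pullback_cancel (K T I R S J : E) (p1 : hom K T) (p2 : hom T I)
    (q1 : hom R S) (q2 : hom S J) (f : hom K R) (c : hom T S) (g : hom I J) :
  f ;; q1 = p1 ;; c -> is_pullback c p2 q2 g -> is_pullback f (p1 ;; p2) (q1 ;; q2) g ->
  is_pullback f p1 q1 c.
Proof.
move=> sq H2 H; apply: pullback_intro => //.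
- move=> W x y e.
  have e' : x ;; (q1 ;; q2) = (y ;; p2) ;; g by rewrite compA e -!compA (proj1 H2).
  exists (lift H e'); rewrite lift1; split=> //; apply: (pb_ext H2).
  + by rewrite -compA -sq compA lift1.
  by rewrite -compA lift2.
move=> W w w' e1 e2; apply: (pb_ext H) => //.
by rewrite !compA e2.
Qed.

Lemma pullback_vpaste (K I R J M N : E) (p : hom K I) (q : hom R J) (r : hom M N)
    (f : hom K R) (g : hom I J) (f' : hom R M) (g' : hom J N) :
  is_pullback f p q g -> is_pullback f' q r g' -> is_pullback (f ;; f') p r (g ;; g').
Proof.
move=> H1 H2; apply: pullback_intro.
- by rewrite -compA (proj1 H2) !compA (proj1 H1).
- move=> W x y e.
  have e1 : x ;; r = (y ;; g) ;; g' by rewrite e !compA.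
  have e2 : lift H2 e1 ;; q = y ;; g by rewrite lift2.
  by exists (lift H1 e2); rewrite compA lift1 lift1 lift2.
move=> W w w'; rewrite !compA => e1 e2; apply: (pb_ext H1) => //.
apply: (pb_ext H2) => //.
by rewrite -!compA (proj1 H1) !compA e2.
Qed.

Lemma pullback_vcancel (K I R J M N : E) (p : hom K I) (q : hom R J) (r : hom M N)
    (f : hom K R) (g : hom I J) (f' : hom R M) (g' : hom J N) :
  f ;; q = p ;; g -> is_pullback f' q r g' -> is_pullback (f ;; f') p r (g ;; g') ->
  is_pullback f p q g.
Proof.
move=> sq H2 H; apply: pullback_intro => //.
- move=> W x y e.
  have e1 : (x ;; f') ;; r = y ;; (g ;; g') by rewrite -compA (proj1 H2) !compA e.
  exists (lift H e1); rewrite lift2; split=> //; apply: (pb_ext H2).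
  + by rewrite -compA lift1.
  by rewrite -compA sq compA lift2.
by move=> W w w' e1 e2; apply: (pb_ext H) => //; rewrite !compA e1.
Qed.

Lemma pullback_id (A B : E) (p : hom A B) : is_pullback (idm A) p p (idm B).
Proof.
apply: pullback_intro => [|W x y e|W w w' + _]; rewrite ?comp1m ?compm1 //.
by exists x; rewrite compm1 e compm1.
Qed.

Lemma pullback_idl (A B : E) (f : hom A B) : is_pullback f (idm A) (idm B) f.
Proof.
apply: pullback_intro => [|W x y e|W w w' _ +]; rewrite ?comp1m ?compm1 //.
by exists y; rewrite compm1 -e compm1.
Qed.

End PullbackTheory.

Section Slice.
Context {E : Category}.

Record SliceOb (B : E) := Over { sdom : E; smap : hom sdom B }.

Definition SliceHom (B : E) (x y : SliceOb B) :=
  {k : hom (sdom x) (sdom y) | k ;; smap y = smap x}.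

Lemma slice_eq (B : E) (x y : SliceOb B) (k l : SliceHom x y) :
  proj1_sig k = proj1_sig l -> k = l.
Proof.
by case: k l => [k ek] [l el] /= e; subst l; rewrite (proof_irrelevance _ ek el).
Qed.

Definition slice_id (B : E) (x : SliceOb B) : SliceHom x x :=
  exist _ (idm (sdom x)) (comp1m (smap x)).

Lemma slice_comp_subproof (B : E) (x y z : SliceOb B) (k : SliceHom x y) (l : SliceHom y z) :
  (proj1_sig k ;; proj1_sig l) ;; smap z = smap x.
Proof. by rewrite -compA (proj2_sig l) (proj2_sig k). Qed.

Definition slice_comp (B : E) (x y z : SliceOb B) (k : SliceHom x y) (l : SliceHom y z) :
  SliceHom x z := exist _ (proj1_sig k ;; proj1_sig l) (slice_comp_subproof k l).

Definition Slice (B : E) : Category.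
Proof.
refine {| ob := SliceOb B; hom := @SliceHom B; idm := @slice_id B; comp := @slice_comp B |}.
- by move=> *; apply: slice_eq; rewrite /= comp1m.
- by move=> *; apply: slice_eq; rewrite /= compm1.
- by move=> *; apply: slice_eq; rewrite /= compA.
Defined.

Context (K : Pullbacks E) (A B : E) (q : hom A B).

Definition delta_ob (m : Slice B) : Slice A := Over (pb1 K q (smap m)).

Lemma delta_sq (m n : Slice B) (k : hom m n) :
  pb1 K q (smap m) ;; q = (pb2 K q (smap m) ;; proj1_sig k) ;; smap n.
Proof. by rewrite -compA (proj2_sig k) (proj1 (pbP K _ _)). Qed.

Definition delta_map (m n : Slice B) (k : hom m n) : hom (delta_ob m) (delta_ob n) :=
  exist (fun l => l ;; pb1 K q (smap n) = pb1 K q (smap m))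
    (lift (pbP K q (smap n)) (delta_sq k)) (lift1 (pbP K q (smap n)) (delta_sq k)).

(* The pullback functor [E/B -> E/A] along [q : A -> B]. *)
Definition Delta : Functor (Slice B) (Slice A).
Proof.
refine {| fob := delta_ob; fmap := delta_map |}.
- move=> m; apply: slice_eq; apply: (pb_ext (pbP K q (smap m))) => /=.
  + by rewrite lift1 comp1m.
  by rewrite lift2 comp1m compm1.
- move=> l m n f g; apply: slice_eq; apply: (pb_ext (pbP K q (smap n))) => /=.
  + by rewrite -compA !lift1.
  by rewrite -compA !lift2 [in RHS]compA lift2 -compA.
Defined.

End Slice.

Record LCC (E : Category) := {
  lcc_pb : Pullbacks E;
  lcc_pi : forall (A B : E) (q : hom A B), RightAdjoint (Delta lcc_pb q) }.

Record Bicategory := {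
  bob :> Type;
  bhom : bob -> bob -> Category;
  bid : forall X, bhom X X;
  bcomp : forall X Y Z, bhom X Y -> bhom Y Z -> bhom X Z;
  hcomp : forall X Y Z (a a' : bhom X Y) (b b' : bhom Y Z),
    hom a a' -> hom b b' -> hom (bcomp a b) (bcomp a' b');
  assoc : forall W X Y Z (a : bhom W X) (b : bhom X Y) (c : bhom Y Z),
    hom (bcomp a (bcomp b c)) (bcomp (bcomp a b) c);
  assocV : forall W X Y Z (a : bhom W X) (b : bhom X Y) (c : bhom Y Z),
    hom (bcomp (bcomp a b) c) (bcomp a (bcomp b c));
  lunitor : forall X Y (a : bhom X Y), hom a (bcomp (bid X) a);
  lunitorV : forall X Y (a : bhom X Y), hom (bcomp (bid X) a) a;
  runitor : forall X Y (a : bhom X Y), hom a (bcomp a (bid Y));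
  runitorV : forall X Y (a : bhom X Y), hom (bcomp a (bid Y)) a;
  hcomp1 : forall X Y Z (a : bhom X Y) (b : bhom Y Z),
    hcomp (idm a) (idm b) = idm (bcomp a b);
  hcompM : forall X Y Z (a a' a'' : bhom X Y) (b b' b'' : bhom Y Z)
    (x : hom a a') (x' : hom a' a'') (y : hom b b') (y' : hom b' b''),
    hcomp (x ;; x') (y ;; y') = hcomp x y ;; hcomp x' y';
  assocK : forall W X Y Z (a : bhom W X) (b : bhom X Y) (c : bhom Y Z),
    assoc a b c ;; assocV a b c = idm _;
  assocVK : forall W X Y Z (a : bhom W X) (b : bhom X Y) (c : bhom Y Z),
    assocV a b c ;; assoc a b c = idm _;
  lunitorK : forall X Y (a : bhom X Y), lunitor a ;; lunitorV a = idm _;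
  lunitorVK : forall X Y (a : bhom X Y), lunitorV a ;; lunitor a = idm _;
  runitorK : forall X Y (a : bhom X Y), runitor a ;; runitorV a = idm _;
  runitorVK : forall X Y (a : bhom X Y), runitorV a ;; runitor a = idm _;
  assoc_nat : forall W X Y Z (a a' : bhom W X) (b b' : bhom X Y) (c c' : bhom Y Z)
    (x : hom a a') (y : hom b b') (z : hom c c'),
    hcomp x (hcomp y z) ;; assoc a' b' c' = assoc a b c ;; hcomp (hcomp x y) z;
  lunitor_nat : forall X Y (a a' : bhom X Y) (x : hom a a'),
    x ;; lunitor a' = lunitor a ;; hcomp (idm (bid X)) x;
  runitor_nat : forall X Y (a a' : bhom X Y) (x : hom a a'),
    x ;; runitor a' = runitor a ;; hcomp x (idm (bid Y));
  pentagon : forall V W X Y Z (a : bhom V W) (b : bhom W X) (c : bhom X Y) (d : bhom Y Z),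
    assoc a b (bcomp c d) ;; assoc (bcomp a b) c d =
    hcomp (idm a) (assoc b c d) ;; assoc a (bcomp b c) d ;; hcomp (assoc a b c) (idm d);
  triangle : forall X Y Z (a : bhom X Y) (b : bhom Y Z),
    hcomp (idm a) (lunitor b) ;; assoc a (bid Y) b = hcomp (runitor a) (idm b) }.

Arguments bhom {_} _ _.
Arguments bid {_} _.
Arguments bcomp {_ _ _ _} _ _.
Arguments hcomp {_ _ _ _ _ _ _ _} _ _.
Arguments assoc {_ _ _ _ _} _ _ _.
Arguments assocV {_ _ _ _ _} _ _ _.
Arguments lunitor {_ _ _} _.
Arguments lunitorV {_ _ _} _.
Arguments runitor {_ _ _} _.
Arguments runitorV {_ _ _} _.

Notation "a ⊙ b" := (bcomp a b) (at level 39, left associativity) : cat_scope.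
Notation "x ⊗ y" := (hcomp x y) (at level 39, left associativity) : cat_scope.

Record LocalFunctor (A C : Bicategory) := {
  lob :> A -> C;
  lhom : forall X Y : A, Functor (bhom X Y) (bhom (lob X) (lob Y)) }.

Arguments lhom {A C} _ {X Y}.

Record OplaxStructure (A C : Bicategory) (L : LocalFunctor A C) := {
  oplax_comp : forall (X Y Z : A) (a : bhom X Y) (b : bhom Y Z),
    hom (lhom L (a ⊙ b)) (lhom L a ⊙ lhom L b);
  oplax_unit : forall X : A, hom (lhom L (bid X)) (bid (L X));
  oplax_nat : forall (X Y Z : A) (a a' : bhom X Y) (b b' : bhom Y Z)
    (x : hom a a') (y : hom b b'),
    oplax_comp a' b' ∘ fmap (lhom L) (x ⊗ y)
    = (fmap (lhom L) x ⊗ fmap (lhom L) y) ∘ oplax_comp a b;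
  oplax_assoc : forall (W X Y Z : A) (a : bhom W X) (b : bhom X Y) (c : bhom Y Z),
    (oplax_comp a b ⊗ idm (lhom L c)) ∘ oplax_comp (a ⊙ b) c ∘ fmap (lhom L) (assoc a b c)
    = assoc (lhom L a) (lhom L b) (lhom L c)
      ∘ (idm (lhom L a) ⊗ oplax_comp b c) ∘ oplax_comp a (b ⊙ c);
  oplax_lunit : forall (X Y : A) (a : bhom X Y),
    (oplax_unit X ⊗ idm (lhom L a)) ∘ oplax_comp (bid X) a ∘ fmap (lhom L) (lunitor a)
    = lunitor (lhom L a);
  oplax_runit : forall (X Y : A) (a : bhom X Y),
    (idm (lhom L a) ⊗ oplax_unit Y) ∘ oplax_comp a (bid Y) ∘ fmap (lhom L) (runitor a)
    = runitor (lhom L a) }.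

Section Polynomials.
Context {E : Category}.

Set Primitive Projections.
Record Poly (X Z : E) := MkPoly {
  pE : E; pB : E;
  ps : hom pE X; pp : hom pE pB; pt : hom pB Z }.
Unset Primitive Projections.

Definition idpoly (X : E) : Poly X X := MkPoly (idm X) (idm X) (idm X).

Record is_cell (X Z : E) (P Q : Poly X Z) (f : hom (pE P) (pE Q)) (g : hom (pB P) (pB Q))
    : Prop := {
  cell_src : f ;; ps Q = ps P;
  cell_tgt : g ;; pt Q = pt P;
  cell_pb : is_pullback f (pp P) (pp Q) g }.

Record PCell (X Z : E) (P Q : Poly X Z) := Cell {
  ctop : hom (pE P) (pE Q);
  cbot : hom (pB P) (pB Q);
  cellP : is_cell ctop cbot }.

Lemma cell_eq (X Z : E) (P Q : Poly X Z) (x y : PCell P Q) :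
  ctop x = ctop y -> cbot x = cbot y -> x = y.
Proof.
case: x y => [f g c] [f' g' c'] /= ef eg; subst f' g'.
by rewrite (proof_irrelevance _ c c').
Qed.

Lemma is_cell_id (X Z : E) (P : Poly X Z) : is_cell (idm (pE P)) (idm (pB P)).
Proof. by split; rewrite ?comp1m //; apply: pullback_id. Qed.

Lemma is_cell_comp (X Z : E) (P Q R : Poly X Z) (x : PCell P Q) (y : PCell Q R) :
  is_cell (ctop x ;; ctop y) (cbot x ;; cbot y).
Proof.
case: x y => [f g [s t b]] [f' g' [s' t' b']] /=; split.
- by rewrite -compA s'.
- by rewrite -compA t'.
exact: pullback_vpaste b b'.
Qed.

Definition pcell_id (X Z : E) (P : Poly X Z) : PCell P P := Cell (is_cell_id P).
Definition pcell_comp (X Z : E) (P Q R : Poly X Z) (x : PCell P Q) (y : PCell Q R) :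
  PCell P R := Cell (is_cell_comp x y).

Definition PolyHom (X Z : E) : Category.
Proof.
refine {| ob := Poly X Z; hom := @PCell X Z; idm := @pcell_id X Z; comp := @pcell_comp X Z |}.
- by move=> *; apply: cell_eq; rewrite /= comp1m.
- by move=> *; apply: cell_eq; rewrite /= compm1.
- by move=> *; apply: cell_eq; rewrite /= compA.
Defined.

Lemma is_cell_diag (X R T : E) (s : hom R X) (t : hom T X) (f : hom R T) (e : f ;; t = s) :
  @is_cell X X (MkPoly s (idm R) s) (MkPoly t (idm T) t) f f.
Proof. by split=> //=; apply: pullback_idl. Qed.

Definition diag_cell (X R T : E) (s : hom R X) (t : hom T X) (f : hom R T) (e : f ;; t = s) :
  PCell (MkPoly s (idm R) s) (MkPoly t (idm T) t) := Cell (is_cell_diag e).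

(* [(h,h) : (h,1,h) -> (1,1,1)]. *)
Definition to_id_cell (X T : E) (h : hom T X) : PCell (MkPoly h (idm T) h) (idpoly X) :=
  diag_cell (compm1 h).

Lemma to_idpoly_eq (X : E) (P : Poly X X) (x y : PCell P (idpoly X)) : x = y.
Proof.
case: x y => [f g [s t b]] [f' g' [s' t' b']]; apply: cell_eq => /=.
- by rewrite -(compm1 f) -(compm1 f') s s'.
by rewrite -(compm1 g) -(compm1 g') t t'.
Qed.

End Polynomials.

Section PolyComposition.
Context {E : Category} (K : LCC E).
Let pbk := lcc_pb K.

(* For [P = (s,p,t)] and [Q = (u,q,v)], with [Q] on the base [C]:
   [cBF] is [B x_Y F], [cD -> C] is [Pi_q (B x_Y F -> F)], [cFD] is [F x_C D]
   and [cN] is [E x_B (F x_C D)]. *)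
Section Pieces.
Context {X Y Z : E} (P : Poly X Y) (Q : Poly Y Z).

Definition cBF : E := pb pbk (pt P) (ps Q).
Definition cPi : SliceOb (pB Q) :=
  radj (lcc_pi K (pp Q)) (Over (pb2 pbk (pt P) (ps Q))).
Definition cD : E := sdom cPi.
Definition cDC : hom cD (pB Q) := smap cPi.
Definition cFD : E := pb pbk (pp Q) cDC.
Definition cFDF : hom cFD (pE Q) := pb1 pbk (pp Q) cDC.
Definition cFDD : hom cFD cD := pb2 pbk (pp Q) cDC.
Definition cev : hom cFD cBF :=
  proj1_sig (counit (lcc_pi K (pp Q)) (Over (pb2 pbk (pt P) (ps Q)))).
Definition cFDB : hom cFD (pB P) := cev ;; pb1 pbk (pt P) (ps Q).
Definition cN : E := pb pbk (pp P) cFDB.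
Definition cNE : hom cN (pE P) := pb1 pbk (pp P) cFDB.
Definition cNFD : hom cN cFD := pb2 pbk (pp P) cFDB.

Definition pcomp : Poly X Z := MkPoly (cNE ;; ps P) (cNFD ;; cFDD) (cDC ;; pt Q).

(* [pcomp] factors through [cFD] as two composable polynomials, over [P] and [Q]. *)
Definition leftpart : Poly X Y := MkPoly (cNE ;; ps P) cNFD (cFDF ;; ps Q).
Definition rightpart : Poly Y Z := MkPoly (cFDF ;; ps Q) cFDD (cDC ;; pt Q).

Lemma cevF : cev ;; pb2 pbk (pt P) (ps Q) = cFDF.
Proof. exact: (proj2_sig (counit (lcc_pi K (pp Q)) (Over (pb2 pbk (pt P) (ps Q))))). Qed.

Lemma is_cell_left : @is_cell _ _ _ leftpart P cNE cFDB.
Proof.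
split=> //=; last exact: pbP.
by rewrite /cFDB -compA (proj1 (pbP _ _ _)) compA cevF.
Qed.

Lemma is_cell_right : @is_cell _ _ _ rightpart Q cFDF cDC.
Proof. by split=> //=; apply: pbP. Qed.

Definition leftcell : PCell leftpart P := Cell is_cell_left.
Definition rightcell : PCell rightpart Q := Cell is_cell_right.

Context (S T I : E) (s : hom S X) (p1 : hom S T) (h : hom T Y) (p2 : hom T I) (t : hom I Z)
  (x : PCell (MkPoly s p1 h) P) (y : PCell (MkPoly h p2 t) Q).

(* [(f,c,g)] factors the pair of cells [x], [y] through [leftcell], [rightcell]. *)
Record is_fact (f : hom S cN) (c : hom T cFD) (g : hom I cD) : Prop := {
  fact_left : @is_cell _ _ _ (MkPoly s p1 h) leftpart f c;
  fact_right : @is_cell _ _ _ (MkPoly h p2 t) rightpart c g;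
  fact_l1 : f ;; cNE = ctop x;
  fact_l2 : c ;; cFDB = cbot x;
  fact_r1 : c ;; cFDF = ctop y;
  fact_r2 : g ;; cDC = cbot y }.

Lemma fact_unique f c g f' c' g' :
  is_fact f c g -> is_fact f' c' g' -> f = f' /\ c = c' /\ g = g'.
Proof.
move=> [[sf tf bf] [_ tg bg] l1 l2 r1 r2] [[sf' tf' bf'] [_ tg' bg'] l1' l2' r1' r2'].
rewrite /= in sf tf bf tg bg sf' tf' bf' tg' bg'.
have py : is_pullback (ctop y) p2 (pp Q) (cbot y) by exact: cell_pb (cellP y).
pose m : SliceOb (pB Q) := Over (cbot y).
pose k : SliceHom m cPi := exist (fun k : hom (sdom m) (sdom cPi) => k ;; smap cPi = smap m) g r2.
pose k' : SliceHom m cPi := exist (fun k : hom (sdom m) (sdom cPi) => k ;; smap cPi = smap m) g' r2'.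
have ev : c ;; cev = c' ;; cev.
  apply: (pb_ext (pbP pbk (pt P) (ps Q))).
  + by rewrite -!compA l2 l2'.
  by rewrite -!compA cevF r1 r1'.
have j : exists j : hom (pb pbk (pp Q) (cbot y)) T,
    j ;; ctop y = pb1 pbk (pp Q) (cbot y) /\ j ;; p2 = pb2 pbk (pp Q) (cbot y).
  by exists (lift py (proj1 (pbP pbk (pp Q) (cbot y)))); rewrite lift1 lift2.
case: j => j [j1 j2].
have dk (l : SliceHom m cPi) (d : hom T cFD) : d ;; cFDF = ctop y ->
    d ;; cFDD = p2 ;; proj1_sig l -> proj1_sig (fmap (Delta pbk (pp Q)) l) = j ;; d.
  move=> d1 d2; apply: (pb_ext (pbP pbk (pp Q) cDC)) => /=.
  + by rewrite lift1 -compA -[pb1 pbk (pp Q) cDC]/cFDF d1 j1.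
  by rewrite lift2 -compA -[pb2 pbk (pp Q) cDC]/cFDD d2 compA j2.
have [z [_ uz]] := radj_univ (lcc_pi K (pp Q))
   (fmap (Delta pbk (pp Q)) k ;; counit (lcc_pi K (pp Q)) (Over (pb2 pbk (pt P) (ps Q)))).
have ek : k = k'.
  rewrite -(uz k) // -(uz k') //; apply: slice_eq => /=.
  have := dk k c r1 (proj1 bg); have := dk k' c' r1' (proj1 bg') => /= -> ->.
  by rewrite -!compA; congr (_ ;; _); rewrite -/cev ev.
have eg : g = g' by exact: (f_equal (@proj1_sig _ _) ek).
have ec : c = c'.
  apply: (pb_ext (pbP pbk (pp Q) cDC)); first by rewrite -[pb1 pbk (pp Q) cDC]/cFDF r1 r1'.
  by rewrite -[pb2 pbk (pp Q) cDC]/cFDD (proj1 bg) (proj1 bg') eg.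
split=> //; apply: (pb_ext (pbP pbk (pp P) cFDB)).
- by rewrite -[pb1 pbk (pp P) cFDB]/cNE l1 l1'.
by rewrite -[pb2 pbk (pp P) cFDB]/cNFD (proj1 bf) (proj1 bf') ec.
Qed.

Lemma fact_exists : exists fcg : hom S cN * hom T cFD * hom I cD,
  is_fact fcg.1.1 fcg.1.2 fcg.2.
Proof.
have [sx tx bx] := cellP x; have [sy ty by_] := cellP y; rewrite /= in sx tx bx sy ty by_.
pose m : SliceOb (pB Q) := Over (cbot y).
have exj : exists j : hom (pb pbk (pp Q) (cbot y)) T,
    j ;; ctop y = pb1 pbk (pp Q) (cbot y) /\ j ;; p2 = pb2 pbk (pp Q) (cbot y).
  by exists (lift by_ (proj1 (pbP pbk (pp Q) (cbot y)))); rewrite lift1 lift2.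
case: exj => j [j1 j2].
have eb : cbot x ;; pt P = ctop y ;; ps Q by rewrite tx sy.
pose b := lift (pbP pbk (pt P) (ps Q)) eb.
have eu : (j ;; b) ;; pb2 pbk (pt P) (ps Q) = pb1 pbk (pp Q) (cbot y).
  by rewrite -compA lift2 j1.
pose u : SliceHom (Delta pbk (pp Q) m) (Over (pb2 pbk (pt P) (ps Q))) :=
  exist (fun k => k ;; pb2 pbk (pt P) (ps Q) = pb1 pbk (pp Q) (cbot y)) (j ;; b) eu.
have [[g eg] [ek _]] := radj_univ (lcc_pi K (pp Q)) (u : hom (_ : Slice _) (_ : Slice _)).
have ek' := f_equal (@proj1_sig _ _) ek; rewrite /= -/cev in ek'.
have eg' : g ;; cDC = cbot y := eg.
have ec : ctop y ;; pp Q = (p2 ;; g) ;; cDC by rewrite -compA eg' (proj1 by_).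
pose c := lift (pbP pbk (pp Q) cDC) ec.
have c1 : c ;; cFDF = ctop y by exact: lift1.
have c2 : c ;; cFDD = p2 ;; g by exact: lift2.
have cev_b : c ;; cev = b.
  pose i := lift (pbP pbk (pp Q) (cbot y)) (proj1 by_).
  have ij : i ;; j = idm _.
    by apply: (pb_ext by_); rewrite -compA comp1m ?j1 ?j2 ?lift1 ?lift2.
  rewrite -[b]comp1m -ij -compA -ek' compA; congr (_ ;; _).
  apply: (pb_ext (pbP pbk (pp Q) cDC)).
  + by rewrite -compA !lift1.
  by rewrite -compA !lift2 compA lift2.
have cB : c ;; cFDB = cbot x by rewrite /cFDB compA cev_b lift1.
have ef : ctop x ;; pp P = (p1 ;; c) ;; cFDB by rewrite -compA cB (proj1 bx).
pose f := lift (pbP pbk (pp P) cFDB) ef.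
have f1 : f ;; cNE = ctop x by exact: lift1.
have f2 : f ;; cNFD = p1 ;; c by exact: lift2.
exists (f, c, g); split=> //=; split=> //=.
- by rewrite compA f1 sx.
- by rewrite compA c1 sy.
- apply: (pullback_vcancel f2 (pbP pbk (pp P) cFDB)).
  by rewrite -[pb1 pbk (pp P) cFDB]/cNE f1 cB.
- by rewrite compA c1 sy.
- by rewrite compA eg' ty.
apply: (pullback_vcancel c2 (pbP pbk (pp Q) cDC)).
by rewrite -[pb1 pbk (pp Q) cDC]/cFDF c1 eg'.
Qed.

Lemma fact_cell f c g (p : hom S I) (e : p = p1 ;; p2) :
  is_fact f c g -> @is_cell _ _ _ (MkPoly s p t) pcomp f g.
Proof.
move=> [[sf _ bf] [_ tg bg] _ _ _ _]; split=> //=; rewrite e.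
exact: pullback_paste bf bg.
Qed.

Definition fact_sig := constructive_indefinite_description _ fact_exists.
Definition ftop : hom S cN := (proj1_sig fact_sig).1.1.
Definition fmid : hom T cFD := (proj1_sig fact_sig).1.2.
Definition fbot : hom I cD := (proj1_sig fact_sig).2.
Lemma factP : is_fact ftop fmid fbot. Proof. exact: (proj2_sig fact_sig). Qed.

(* The 2-cell into [P;Q] induced by a factorization of the middle map and cells
   from the two parts to [P] and to [Q]. *)
Definition induced (p : hom S I) (e : p = p1 ;; p2) : PCell (MkPoly s p t) pcomp :=
  Cell (fact_cell e factP).

Lemma pair_eq f c g (p : hom S I) (e : p = p1 ;; p2) (z : PCell (MkPoly s p t) pcomp) :
  is_fact f c g -> ctop z = f -> cbot z = g -> z = induced e.
Proof.
move=> H ef eg; have [? [? ?]] := fact_unique H factP; apply: cell_eq => /=; congruence.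
Qed.

End Pieces.

Lemma pair_pre (X Y Z : E) (P : Poly X Y) (Q : Poly Y Z)
  (S T I S' T' I' : E)
  (s : hom S X) (p1 : hom S T) (h : hom T Y) (p2 : hom T I) (t : hom I Z)
  (s' : hom S' X) (p1' : hom S' T') (h' : hom T' Y) (p2' : hom T' I') (t' : hom I' Z)
  (p : hom S I) (p' : hom S' I') (e : p = p1 ;; p2) (e' : p' = p1' ;; p2')
  (z : PCell (MkPoly s p t) (MkPoly s' p' t'))
  (z1 : PCell (MkPoly s p1 h) (MkPoly s' p1' h'))
  (z2 : PCell (MkPoly h p2 t) (MkPoly h' p2' t'))
  (x : PCell (MkPoly s' p1' h') P) (y : PCell (MkPoly h' p2' t') Q) :
  ctop z1 = ctop z -> cbot z1 = ctop z2 -> cbot z2 = cbot z ->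
  pcell_comp z (induced x y e') = induced (pcell_comp z1 x) (pcell_comp z2 y) e.
Proof.
move=> h1 h2 h3; have [fl fr l1 l2 r1 r2] := factP x y.
apply: (@pair_eq _ _ _ _ _ _ _ _ _ _ _ _ _ _ _ (ctop z ;; ftop x y) (cbot z1 ;; fmid x y)
   (cbot z ;; fbot x y)) => //; split.
- by rewrite -h1; exact: (is_cell_comp z1 (Cell fl)).
- by rewrite h2 -h3; exact: (is_cell_comp z2 (Cell fr)).
- by rewrite -compA l1 -h1.
- by rewrite -compA l2.
- by rewrite -compA r1 h2.
by rewrite -compA r2 -h3.
Qed.

Lemma pair_id (X Y Z : E) (P : Poly X Y) (Q : Poly Y Z) :
  pcell_id (pcomp P Q) = induced (leftcell P Q) (rightcell P Q) (erefl (cNFD P Q ;; cFDD P Q)).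
Proof.
apply: (@pair_eq _ _ _ _ _ _ _ _ _ _ _ _ _ _ _ (idm _) (idm _) (idm _)) => //.
by split; rewrite ?comp1m //; exact: is_cell_id.
Qed.

(* A presentation of a 2-cell into a composite as one induced by a factorization. *)
Record Splitting (X Y Z : E) (P : Poly X Y) (Q : Poly Y Z) (A : Poly X Z)
    (z : PCell A (pcomp P Q)) := {
  splT : E;
  spl1 : hom (pE A) splT;
  splh : hom splT Y;
  spl2 : hom splT (pB A);
  splE : pp A = spl1 ;; spl2;
  splx : PCell (MkPoly (ps A) spl1 splh) P;
  sply : PCell (MkPoly splh spl2 (pt A)) Q;
  splK : z = induced splx sply splE }.

(* The factorization is obtained by pulling back [cFDD] along the base of the 2-cell. *)
Definition split_cell (X Y Z : E) (P : Poly X Y) (Q : Poly Y Z) (A : Poly X Z)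
    (z : PCell A (pcomp P Q)) : Splitting z.
Proof.
have bz := cell_pb (cellP z).
pose H := pbP pbk (cFDD P Q) (cbot z).
have e1 : (ctop z ;; cNFD P Q) ;; cFDD P Q = pp A ;; cbot z.
  by rewrite -compA; exact: (proj1 bz).
pose c := pb1 pbk (cFDD P Q) (cbot z); pose p2 := pb2 pbk (cFDD P Q) (cbot z).
pose p1 := lift H e1.
have p11 : p1 ;; c = ctop z ;; cNFD P Q by exact: lift1.
have p12 : pp A = p1 ;; p2 by rewrite lift2.
have fl : @is_cell _ _ _ (MkPoly (ps A) p1 (c ;; (cFDF P Q ;; ps Q))) (leftpart P Q) (ctop z) c.
  split=> //=; first exact: (cell_src (cellP z)).
  by apply: (pullback_cancel (esym p11) H); rewrite -/p2 -p12.
have fr : @is_cell _ _ _ (MkPoly (c ;; (cFDF P Q ;; ps Q)) p2 (pt A)) (rightpart P Q) c (cbot z).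
  by split=> //=; exact: (cell_tgt (cellP z)).
apply: (@Build_Splitting _ _ _ P Q A z _ p1 _ p2 p12
  (pcell_comp (Cell fl) (leftcell P Q)) (pcell_comp (Cell fr) (rightcell P Q))).
by apply: (@pair_eq _ _ _ _ _ _ _ _ _ _ _ _ _ _ _ (ctop z) c (cbot z)).
Defined.

Lemma pair_gen (X Y Z : E) (P : Poly X Y) (Q : Poly Y Z)
  (S T I S' T' I' : E)
  (s : hom S X) (p1 : hom S T) (h : hom T Y) (p2 : hom T I) (t : hom I Z)
  (s' : hom S' X) (p1' : hom S' T') (h' : hom T' Y) (p2' : hom T' I') (t' : hom I' Z)
  (p : hom S I) (p' : hom S' I') (e : p = p1 ;; p2) (e' : p' = p1' ;; p2')
  (z : PCell (MkPoly s p t) (MkPoly s' p' t'))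
  (x : PCell (MkPoly s p1 h) P) (y : PCell (MkPoly h p2 t) Q)
  (x' : PCell (MkPoly s' p1' h') P) (y' : PCell (MkPoly h' p2' t') Q) :
  pcell_comp z (induced x' y' e') = induced x y e ->
  exists (z1 : PCell (MkPoly s p1 h) (MkPoly s' p1' h'))
         (z2 : PCell (MkPoly h p2 t) (MkPoly h' p2' t')),
    [/\ ctop z1 = ctop z, cbot z1 = ctop z2, cbot z2 = cbot z,
        pcell_comp z1 x' = x & pcell_comp z2 y' = y].
Proof.
move=> ez; subst p p'; have [fl fr l1 l2 r1 r2] := factP x y.
have [fl' fr' l1' l2' r1' r2'] := factP x' y'.
have et : ctop z ;; ftop x' y' = ftop x y := f_equal (@ctop _ _ _ _ _) ez.
have eb : cbot z ;; fbot x' y' = fbot x y := f_equal (@cbot _ _ _ _ _) ez.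
have [sz tz bz] := cellP z; rewrite /= in sz tz bz.
have H := cell_pb fr'; rewrite /= in H.
have ec : fmid x y ;; cFDD P Q = (p2 ;; cbot z) ;; fbot x' y'.
  by rewrite -compA eb; exact: (proj1 (cell_pb fr)).
pose c := lift H ec.
have c1 : c ;; fmid x' y' = fmid x y by exact: lift1.
have c2 : c ;; p2' = p2 ;; cbot z by exact: lift2.
have ch : c ;; h' = h.
  by have /= <- := cell_tgt fl'; rewrite compA c1; exact: (cell_tgt fl).
have sq1 : ctop z ;; p1' = p1 ;; c.
  apply: (pb_ext H).
  + rewrite -!compA c1; have /= <- := proj1 (cell_pb fl'); rewrite compA et.
    exact: (proj1 (cell_pb fl)).
  by rewrite -!compA c2 (proj1 bz) compA.
have k2 : @is_cell _ _ _ (MkPoly h p2 t) (MkPoly h' p2' t') c (cbot z).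
  split=> //=; apply: (pullback_vcancel c2 H).
  by rewrite c1 eb; exact: (cell_pb fr).
have k1 : @is_cell _ _ _ (MkPoly s p1 h) (MkPoly s' p1' h') (ctop z) c.
  by split=> //=; apply: (pullback_cancel sq1 (cell_pb k2)).
exists (Cell k1), (Cell k2); split=> //; apply: cell_eq => /=.
- by rewrite -l1' compA et.
- by rewrite -l2' compA c1.
- by rewrite -r1' compA c1.
by rewrite -r2' compA eb.
Qed.

Definition pcell_hcomp (X Y Z : E) (P P' : Poly X Y) (Q Q' : Poly Y Z)
    (x : PCell P P') (y : PCell Q Q') : PCell (pcomp P Q) (pcomp P' Q') :=
  induced (pcell_comp (leftcell P Q) x) (pcell_comp (rightcell P Q) y) erefl.

Lemma is_cell_paste (X Y Z S T I S' T' I' : E)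
  (s : hom S X) (p1 : hom S T) (h : hom T Y) (p2 : hom T I) (t : hom I Z)
  (s' : hom S' X) (p1' : hom S' T') (h' : hom T' Y) (p2' : hom T' I') (t' : hom I' Z)
  (p : hom S I) (p' : hom S' I') (e : p = p1 ;; p2) (e' : p' = p1' ;; p2')
  (z1 : PCell (MkPoly s p1 h) (MkPoly s' p1' h'))
  (z2 : PCell (MkPoly h p2 t) (MkPoly h' p2' t')) :
  cbot z1 = ctop z2 -> @is_cell _ _ _ (MkPoly s p t) (MkPoly s' p' t') (ctop z1) (cbot z2).
Proof.
case: z1 z2 => [f c [sf _ bf]] [c' g [_ tg bg]] /= ec; subst c'; split=> //=.
by rewrite e e'; exact: pullback_paste bf bg.
Qed.

Definition paste_cell (X Y Z S T I S' T' I' : E)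
  (s : hom S X) (p1 : hom S T) (h : hom T Y) (p2 : hom T I) (t : hom I Z)
  (s' : hom S' X) (p1' : hom S' T') (h' : hom T' Y) (p2' : hom T' I') (t' : hom I' Z)
  (p : hom S I) (p' : hom S' I') (e : p = p1 ;; p2) (e' : p' = p1' ;; p2')
  (z1 : PCell (MkPoly s p1 h) (MkPoly s' p1' h'))
  (z2 : PCell (MkPoly h p2 t) (MkPoly h' p2' t')) (ez : cbot z1 = ctop z2) :
  PCell (MkPoly s p t) (MkPoly s' p' t') := Cell (is_cell_paste e e' ez).

Lemma pcompA (X Z : E) (P Q R S : Poly X Z) (x : PCell P Q) (y : PCell Q R) (z : PCell R S) :
  pcell_comp x (pcell_comp y z) = pcell_comp (pcell_comp x y) z.
Proof. by apply: cell_eq; rewrite /= compA. Qed.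
Lemma pcomp1m (X Z : E) (P Q : Poly X Z) (x : PCell P Q) : pcell_comp (pcell_id P) x = x.
Proof. by apply: cell_eq; rewrite /= comp1m. Qed.
Lemma pcompm1 (X Z : E) (P Q : Poly X Z) (x : PCell P Q) : pcell_comp x (pcell_id Q) = x.
Proof. by apply: cell_eq; rewrite /= compm1. Qed.

Section PairComp.
Context (X Y Z : E) (P : Poly X Y) (Q : Poly Y Z)
  (S T I : E) (s : hom S X) (p1 : hom S T) (h : hom T Y) (p2 : hom T I) (t : hom I Z)
  (p : hom S I) (e : p = p1 ;; p2)
  (x : PCell (MkPoly s p1 h) P) (y : PCell (MkPoly h p2 t) Q).

Lemma pair_split : exists
  (z1 : PCell (MkPoly s p1 h) (leftpart P Q)) (z2 : PCell (MkPoly h p2 t) (rightpart P Q)),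
  [/\ ctop z1 = ctop (induced x y e), cbot z1 = ctop z2, cbot z2 = cbot (induced x y e),
      pcell_comp z1 (leftcell P Q) = x & pcell_comp z2 (rightcell P Q) = y].
Proof.
apply: (@pair_gen _ _ _ P Q _ _ _ _ _ _ _ _ _ _ _ _ _ _ _ _ _ _ e erefl).
by rewrite -pair_id pcompm1.
Qed.

Lemma pair_hcomp (P' : Poly X Y) (Q' : Poly Y Z) (x' : PCell P P') (y' : PCell Q Q') :
  pcell_comp (induced x y e) (pcell_hcomp x' y') = induced (pcell_comp x x') (pcell_comp y y') e.
Proof.
have [z1 [z2 [h1 h2 h3 hx hy]]] := pair_split.
by rewrite /pcell_hcomp (pair_pre e _ _ _ (z1 := z1) (z2 := z2)) // !pcompA hx hy.
Qed.
End PairComp.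

Section Assoc.
Context {W X Y Z : E} (P : Poly W X) (Q : Poly X Y) (R : Poly Y Z).

Lemma passoc_eq (p : hom (pE (pcomp P (pcomp Q R))) (pB (pcomp P (pcomp Q R)))) S T
    (p1 : hom _ S) (p23 : hom S _) (p2 : hom S T) (p3 : hom T _) :
  p = p1 ;; p23 -> p23 = p2 ;; p3 -> p = (p1 ;; p2) ;; p3.
Proof. by move=> -> ->; rewrite compA. Qed.

(* The right part of [P;(Q;R)] maps to [Q;R], and is split accordingly. *)
Definition passoc : PCell (pcomp P (pcomp Q R)) (pcomp (pcomp P Q) R) :=
  let d := split_cell (rightcell P (pcomp Q R)) in
  induced (induced (leftcell P (pcomp Q R)) (splx d) erefl) (sply d) (passoc_eq erefl (splE d)).

Lemma passocV_eq (p : hom (pE (pcomp (pcomp P Q) R)) (pB (pcomp (pcomp P Q) R))) S T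
    (p12 : hom _ T) (p1 : hom _ S) (p2 : hom S T) (p3 : hom T _) :
  p = p12 ;; p3 -> p12 = p1 ;; p2 -> p = p1 ;; (p2 ;; p3).
Proof. by move=> -> ->; rewrite compA. Qed.

(* The left part of [(P;Q);R] maps to [P;Q], and is split accordingly. *)
Definition passocV : PCell (pcomp (pcomp P Q) R) (pcomp P (pcomp Q R)) :=
  let d := split_cell (leftcell (pcomp P Q) R) in
  induced (splx d) (induced (sply d) (rightcell (pcomp P Q) R) erefl) (passocV_eq erefl (splE d)).

Context (S T U I : E) (s : hom S W) (p1 : hom S T) (h : hom T X) (p2 : hom T U)
  (k : hom U Y) (p3 : hom U I) (t : hom I Z) (p : hom S I) (p12 : hom S U) (p23 : hom T I)
  (e12 : p12 = p1 ;; p2) (e23 : p23 = p2 ;; p3) (e : p = p1 ;; p23) (e' : p = p12 ;; p3)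
  (x : PCell (MkPoly s p1 h) P) (y : PCell (MkPoly h p2 k) Q) (z : PCell (MkPoly k p3 t) R).

Lemma pair_assoc :
  pcell_comp (induced x (induced y z e23) e) passoc = induced (induced x y e12) z e'.
Proof.
rewrite /passoc; set d := split_cell _.
have [x1 [w [h1 h2 h3 hx hw]]] := pair_split e x (induced y z e23).
move: (hw); rewrite [in X in X -> _](splK d) => /pair_gen [y1 [z1 [k1 k2 k3 hy hz]]].
have xy : ctop y1 = cbot x1 by rewrite h2.
rewrite (pair_pre e' _ _ _ (z1 := paste_cell e12 erefl (esym xy)) (z2 := z1)) ?k3 // hz.
by rewrite (pair_pre e12 _ _ _ (z1 := x1) (z2 := y1)) // hx hy.
Qed.

Lemma pair_assocV :
  pcell_comp (induced (induced x y e12) z e') passocV = induced x (induced y z e23) e.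
Proof.
rewrite /passocV; set d := split_cell _.
have [w [z1 [h1 h2 h3 hw hz]]] := pair_split e' (induced x y e12) z.
move: (hw); rewrite [in X in X -> _](splK d) => /pair_gen [x1 [y1 [k1 k2 k3 hx hy]]].
have yz : cbot y1 = ctop z1 by rewrite k3.
rewrite (pair_pre e _ _ _ (z1 := x1) (z2 := paste_cell e23 erefl yz)) ?k1 // hx.
by rewrite (pair_pre e23 _ _ _ (z1 := y1) (z2 := z1)) // hy hz.
Qed.
End Assoc.

Section Unitors.
Context {X S T : E} (s : hom S X) (p : hom S T) (t : hom T X)
  (x : PCell (MkPoly s p t) (idpoly X)).

Definition over_id_inv : hom T S :=
  lift (cell_pb (cellP x)) (eq_trans (compm1 (cbot x)) (esym (comp1m (cbot x)))).

Lemma over_id_invK : over_id_inv ;; p = idm T.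
Proof. exact: lift2. Qed.

Lemma over_id_Kinv : p ;; over_id_inv = idm S.
Proof.
apply: (pb_ext (cell_pb (cellP x))); rewrite /= -?compA.
- rewrite [over_id_inv ;; _]lift1 comp1m -(proj1 (cell_pb (cellP x))).
  by rewrite compm1.
by rewrite over_id_invK comp1m compm1.
Qed.

Lemma is_cell_over_id (F : E) (u : hom F X) (f : hom S F) (g : hom T F) :
  f = p ;; g -> g ;; u = t ->
  @is_cell _ _ _ (MkPoly s p t) (MkPoly u (idm F) u) f g.
Proof.
move=> ef eg; have [sx tx [sq _]] := cellP x; rewrite /= in sx tx sq.
split=> //=; first by rewrite ef -compA eg -tx compA -sq compm1 sx.
apply: pullback_intro.
- by rewrite compm1.
- move=> V a b; rewrite compm1 => eab.
  exists (b ;; over_id_inv); split; last by rewrite -compA over_id_invK compm1.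
  by rewrite eab ef !compA -(compA b) over_id_invK compm1.
by move=> V w w' _ ew; rewrite -[w]compm1 -[w']compm1 -over_id_Kinv !compA ew.
Qed.
End Unitors.

Lemma pair_idl (X Z S T I : E) (Q : Poly X Z) (s : hom S X) (p1 : hom S T) (h : hom T X)
  (p2 : hom T I) (t : hom I Z) (p : hom S I) (e : p = p1 ;; p2)
  (x x' : PCell (MkPoly s p1 h) (idpoly X)) (y : PCell (MkPoly h p2 t) Q) :
  induced x y e = induced x' y e.
Proof. by rewrite (to_idpoly_eq x x'). Qed.

Lemma pair_idr (X Z S T I : E) (P : Poly X Z) (s : hom S X) (p1 : hom S T) (h : hom T Z)
  (p2 : hom T I) (t : hom I Z) (p : hom S I) (e : p = p1 ;; p2)
  (x : PCell (MkPoly s p1 h) P) (y y' : PCell (MkPoly h p2 t) (idpoly Z)) :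
  induced x y e = induced x y' e.
Proof. by rewrite (to_idpoly_eq y y'). Qed.

Section UnitConstraints.
Context {X Y : E} (P : Poly X Y).

Definition plunit : PCell P (pcomp (idpoly X) P) :=
  induced (to_id_cell (ps P)) (pcell_id P) (esym (comp1m (pp P))).

Definition prunit : PCell P (pcomp P (idpoly Y)) :=
  induced (pcell_id P) (to_id_cell (pt P)) (esym (compm1 (pp P))).

Definition plunitV_left : PCell (leftpart (idpoly X) P) (MkPoly (ps P) (idm _) (ps P)) :=
  Cell (is_cell_over_id (leftcell (idpoly X) P) erefl (cell_src (cellP (rightcell (idpoly X) P)))).

Definition plunitV : PCell (pcomp (idpoly X) P) P :=
  paste_cell erefl (esym (comp1m (pp P)))
    (erefl : cbot plunitV_left = ctop (rightcell (idpoly X) P)).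

Let inv := over_id_inv (rightcell P (idpoly Y)).

Lemma prunitV_eq1 : cFDB P (idpoly Y) = cFDD P (idpoly Y) ;; (inv ;; cFDB P (idpoly Y)).
Proof. by rewrite compA over_id_Kinv comp1m. Qed.

Lemma prunitV_eq2 : (inv ;; cFDB P (idpoly Y)) ;; pt P = cDC P (idpoly Y) ;; idm Y.
Proof.
rewrite -compA [cFDB _ _ ;; _](cell_tgt (cellP (leftcell P (idpoly Y)))) /=.
have := proj1 (cell_pb (cellP (rightcell P (idpoly Y)))) => /= ->.
by rewrite compA over_id_invK comp1m compm1.
Qed.

Definition prunitV_right : PCell (rightpart P (idpoly Y)) (MkPoly (pt P) (idm _) (pt P)) :=
  Cell (is_cell_over_id (rightcell P (idpoly Y)) prunitV_eq1 prunitV_eq2).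

Definition prunitV : PCell (pcomp P (idpoly Y)) P :=
  paste_cell erefl (esym (compm1 (pp P)))
    (erefl : cbot (leftcell P (idpoly Y)) = ctop prunitV_right).

Lemma plunitK : pcell_comp plunit plunitV = pcell_id P.
Proof.
have [_ fr _ _ r1 r2] := factP (to_id_cell (ps P)) (pcell_id P).
apply: cell_eq => /=; last exact: r2.
have [fl _ _ _ _ _] := factP (to_id_cell (ps P)) (pcell_id P).
by rewrite compA [ftop _ _ ;; _](proj1 (cell_pb fl)) /= comp1m r1.
Qed.

Lemma plunitVK : pcell_comp plunitV plunit = pcell_id (pcomp (idpoly X) P).
Proof.
rewrite /plunit (pair_pre erefl _ _ _ (z1 := plunitV_left) (z2 := rightcell (idpoly X) P)) //.
rewrite pair_id pcompm1; exact: pair_idl.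
Qed.

Lemma prunitK : pcell_comp prunit prunitV = pcell_id P.
Proof.
have [_ fr l1 l2 _ _] := factP (pcell_id P) (to_id_cell (pt P)).
apply: cell_eq => /=; first exact: l1.
have := proj1 (cell_pb fr); rewrite /= comp1m => <-.
by rewrite -compA -prunitV_eq1 l2.
Qed.

Lemma prunitVK : pcell_comp prunitV prunit = pcell_id (pcomp P (idpoly Y)).
Proof.
rewrite /prunit (pair_pre erefl _ _ _ (z1 := leftcell P (idpoly Y)) (z2 := prunitV_right)) //.
rewrite pair_id pcompm1; exact: pair_idr.
Qed.
End UnitConstraints.

Lemma plunit_nat (X Y : E) (P Q : Poly X Y) (x : PCell P Q) :
  pcell_comp x (plunit Q) = pcell_comp (plunit P) (pcell_hcomp (pcell_id (idpoly X)) x).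
Proof.
rewrite /plunit pair_hcomp pcompm1 pcomp1m.
rewrite (pair_pre (esym (comp1m (pp P))) _ _ _ (z1 := diag_cell (cell_src (cellP x))) (z2 := x)) //.
rewrite pcompm1; exact: pair_idl.
Qed.

Lemma prunit_nat (X Y : E) (P Q : Poly X Y) (x : PCell P Q) :
  pcell_comp x (prunit Q) = pcell_comp (prunit P) (pcell_hcomp x (pcell_id (idpoly Y))).
Proof.
rewrite /prunit pair_hcomp pcompm1 pcomp1m.
rewrite (pair_pre (esym (compm1 (pp P))) _ _ _ (z1 := x) (z2 := diag_cell (cell_tgt (cellP x)))) //.
rewrite pcompm1; exact: pair_idr.
Qed.

Lemma pcell_hcomp1 (X Y Z : E) (P : Poly X Y) (Q : Poly Y Z) :
  pcell_hcomp (pcell_id P) (pcell_id Q) = pcell_id (pcomp P Q).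
Proof. by rewrite /pcell_hcomp !pcompm1 pair_id. Qed.

Lemma pcell_hcompM (X Y Z : E) (P P' P'' : Poly X Y) (Q Q' Q'' : Poly Y Z)
    (x : PCell P P') (x' : PCell P' P'') (y : PCell Q Q') (y' : PCell Q' Q'') :
  pcell_hcomp (pcell_comp x x') (pcell_comp y y')
  = pcell_comp (pcell_hcomp x y) (pcell_hcomp x' y').
Proof. by rewrite {1 2}/pcell_hcomp pair_hcomp !pcompA. Qed.

Lemma passocK (W X Y Z : E) (P : Poly W X) (Q : Poly X Y) (R : Poly Y Z) :
  pcell_comp (passoc P Q R) (passocV P Q R) = pcell_id _.
Proof.
rewrite -[LHS]pcomp1m pair_id; case: (split_cell (rightcell P (pcomp Q R))) => T p1 h p2 e x y ->.
by rewrite pcompA (pair_assoc erefl e erefl (passoc_eq erefl e))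
  (pair_assocV erefl e erefl (passoc_eq erefl e)).
Qed.

Lemma passocVK (W X Y Z : E) (P : Poly W X) (Q : Poly X Y) (R : Poly Y Z) :
  pcell_comp (passocV P Q R) (passoc P Q R) = pcell_id _.
Proof.
rewrite -[LHS]pcomp1m pair_id; case: (split_cell (leftcell (pcomp P Q) R)) => T p1 h p2 e x y ->.
by rewrite pcompA (pair_assocV e erefl (passocV_eq erefl e) erefl)
  (pair_assoc e erefl (passocV_eq erefl e) erefl).
Qed.

Lemma passoc_nat (W X Y Z : E) (P P' : Poly W X) (Q Q' : Poly X Y) (R R' : Poly Y Z)
    (x : PCell P P') (y : PCell Q Q') (z : PCell R R') :
  pcell_comp (pcell_hcomp x (pcell_hcomp y z)) (passoc P' Q' R')
  = pcell_comp (passoc P Q R) (pcell_hcomp (pcell_hcomp x y) z).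
Proof.
rewrite -[LHS]pcomp1m -[RHS]pcomp1m pair_id.
case: (split_cell (rightcell P (pcomp Q R))) => T p1 h p2 e a b ->.
rewrite !pcompA !pair_hcomp.
by rewrite !(pair_assoc erefl e erefl (passoc_eq erefl e)) !pair_hcomp.
Qed.

Lemma ppentagon_pair (V W X Y Z : E) (P : Poly V W) (Q : Poly W X) (R : Poly X Y) (S : Poly Y Z)
  (A B C D I : E) (s : hom A V) (p1 : hom A B) (h : hom B W) (p2 : hom B C) (k : hom C X)
  (p3 : hom C D) (l : hom D Y) (p4 : hom D I) (t : hom I Z)
  (p : hom A I) (p234 : hom B I) (p34 : hom C I)
  (e : p = p1 ;; p234) (e2 : p234 = p2 ;; p34) (e3 : p34 = p3 ;; p4)
  (a : PCell (MkPoly s p1 h) P) (b : PCell (MkPoly h p2 k) Q)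
  (c : PCell (MkPoly k p3 l) R) (d : PCell (MkPoly l p4 t) S) :
  let q := induced a (induced b (induced c d e3) e2) e in
  pcell_comp q (pcell_comp (passoc P Q (pcomp R S)) (passoc (pcomp P Q) R S))
  = pcell_comp q
     (pcell_comp (pcell_comp (pcell_hcomp (pcell_id P) (passoc Q R S)) (passoc P (pcomp Q R) S))
      (pcell_hcomp (passoc P Q R) (pcell_id S))).
Proof.
move=> q; rewrite {}/q !pcompA pair_hcomp pcompm1.
have f : p234 = (p2 ;; p3) ;; p4 by rewrite e2 e3 compA.
have f' : p = (p1 ;; p2) ;; p34 by rewrite e e2 compA.
have g : p = (p1 ;; (p2 ;; p3)) ;; p4 by rewrite e f compA.
rewrite (pair_assoc erefl e2 e f') (pair_assoc (compA p1 p2 p3) e3 f' g).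
rewrite (pair_assoc erefl e3 e2 f) (pair_assoc erefl f e g) pair_hcomp pcompm1.
by rewrite (pair_assoc erefl erefl erefl (compA p1 p2 p3)).
Qed.

Lemma ppentagon (V W X Y Z : E) (P : Poly V W) (Q : Poly W X) (R : Poly X Y) (S : Poly Y Z) :
  pcell_comp (passoc P Q (pcomp R S)) (passoc (pcomp P Q) R S)
  = pcell_comp (pcell_comp (pcell_hcomp (pcell_id P) (passoc Q R S)) (passoc P (pcomp Q R) S))
      (pcell_hcomp (passoc P Q R) (pcell_id S)).
Proof.
rewrite -[LHS]pcomp1m -[RHS]pcomp1m pair_id.
case: (split_cell (rightcell P (pcomp Q (pcomp R S)))) => T p1 h p2 e a b ->.
case: (split_cell b) => U q1 k q2 e' c d ->; exact: ppentagon_pair.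
Qed.

Lemma ptriangle (X Y Z : E) (P : Poly X Y) (Q : Poly Y Z) :
  pcell_comp (pcell_hcomp (pcell_id P) (plunit Q)) (passoc P (idpoly Y) Q)
  = pcell_hcomp (prunit P) (pcell_id Q).
Proof.
rewrite /pcell_hcomp !pcompm1 /plunit /prunit.
rewrite (pair_pre (esym (comp1m (cFDD P Q))) _ _ _
  (z1 := diag_cell (cell_src (cellP (rightcell P Q)))) (z2 := rightcell P Q)) // pcompm1.
rewrite (pair_pre (esym (compm1 (cNFD P Q))) _ _ _
  (z1 := leftcell P Q) (z2 := diag_cell (cell_tgt (cellP (leftcell P Q))))) // pcompm1.
rewrite (pair_assoc (esym (compm1 (cNFD P Q))) (esym (comp1m (cFDD P Q))) erefl erefl).
by apply: (f_equal (fun w => induced w (rightcell P Q) _)); exact: pair_idr.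
Qed.

Definition PolyC : Bicategory := {|
  bob := ob E;
  bhom := @PolyHom E;
  bid := @idpoly E;
  bcomp := @pcomp : forall X Y Z, PolyHom X Y -> PolyHom Y Z -> PolyHom X Z;
  hcomp := @pcell_hcomp : forall X Y Z (P P' : PolyHom X Y) (Q Q' : PolyHom Y Z), _;
  assoc := @passoc;
  assocV := @passocV;
  lunitor := @plunit;
  lunitorV := @plunitV;
  runitor := @prunit;
  runitorV := @prunitV;
  hcomp1 := @pcell_hcomp1;
  hcompM := @pcell_hcompM;
  assocK := @passocK;
  assocVK := @passocVK;
  lunitorK := @plunitK;
  lunitorVK := @plunitVK;
  runitorK := @prunitK;
  runitorVK := @prunitVK;
  assoc_nat := @passoc_nat;
  lunitor_nat := @plunit_nat;
  runitor_nat := @prunit_nat;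
  pentagon := @ppentagon;
  triangle := @ptriangle |}.
End PolyComposition.

(* [polyob], [polycell] are [MkPoly], [Cell] with the hom-categories of [PolyC K] as types. *)
Definition polyob {E : Category} (K : LCC E) {X R B Z : E}
    (s : hom R X) (p : hom R B) (t : hom B Z) : bhom (X : PolyC K) (Z : PolyC K) :=
  MkPoly s p t.

Definition polycell {E : Category} (K : LCC E) {X Z : E} {P Q : Poly X Z}
    {f : hom (pE P) (pE Q)} {g : hom (pB P) (pB Q)} (H : is_cell f g) :
    @hom (bhom (X : PolyC K) (Z : PolyC K)) P Q :=
  Cell H.

Section GenericStructure.
Context {E : Category} (K : LCC E) (C : Bicategory) (L : LocalFunctor (PolyC K) C).

Definition L1 {X R B Z : E} (s : hom R X) (p : hom R B) (t : hom B Z) : bhom (L X) (L Z) :=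
  lhom L (polyob K s p t).

Definition L2 {X Z : E} {P Q : Poly X Z} {f : hom (pE P) (pE Q)} {g : hom (pB P) (pB Q)}
    (H : is_cell f g) : @hom (bhom (L X) (L Z)) (lhom L P) (lhom L Q) :=
  fmap (lhom L) (polycell K H).

(* [Phi] takes the composite [p] together with a proof of [p = p1 ;; p2], instead of
   having [p1 ;; p2] in its type: the two sides of [Phi_assoc] and of the unit laws
   are then well typed without transport. *)
Record GenericStructure := {
  Phi : forall (X Y Z R T B : E) (s : hom R X) (p1 : hom R T) (h : hom T Y)
      (p2 : hom T B) (t : hom B Z) (p : hom R B) (e : p = p1 ;; p2),
    hom (L1 s p t) (L1 s p1 h ⊙ L1 h p2 t);
  Lam : forall (X T : E) (h : hom T X), hom (L1 h (idm T) h) (bid (L X));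
  Phi_nat : forall (X Y Z R S I F T B : E)
      (u : hom R X) (q1 : hom R S) (k : hom S Y) (q2 : hom S I) (v : hom I Z)
      (q : hom R I) (eq_q : q = q1 ;; q2)
      (s : hom F X) (p1 : hom F T) (h : hom T Y) (p2 : hom T B) (t : hom B Z)
      (p : hom F B) (eq_p : p = p1 ;; p2)
      (f : hom R F) (c : hom S T) (g : hom I B)
      (Hfg : @is_cell E X Z (MkPoly u q v) (MkPoly s p t) f g)
      (Hfc : @is_cell E X Y (MkPoly u q1 k) (MkPoly s p1 h) f c)
      (Hcg : @is_cell E Y Z (MkPoly k q2 v) (MkPoly h p2 t) c g),
    Phi s h t eq_p ∘ L2 Hfg = (L2 Hfc ⊗ L2 Hcg) ∘ Phi u k v eq_q;
  Lam_nat : forall (X R T : E) (s : hom R X) (t : hom T X) (f : hom R T) (e : f ;; t = s),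
    Lam t ∘ L2 (is_cell_diag e) = Lam s;
  Phi_assoc : forall (W X Y Z F G H B : E)
      (s : hom F W) (a : hom F G) (h : hom G X) (b : hom G H) (k : hom H Y)
      (c : hom H B) (t : hom B Z),
    assoc (L1 s a h) (L1 h b k) (L1 k c t)
      ∘ (idm (L1 s a h) ⊗ Phi h k t (erefl (b ;; c)))
      ∘ Phi s h t (erefl (a ;; (b ;; c)))
    = (Phi s h k (erefl (a ;; b)) ⊗ idm (L1 k c t)) ∘ Phi s k t (compA a b c);
  Phi_lunit : forall (X Y R B : E) (s : hom R X) (p : hom R B) (t : hom B Y),
    (Lam s ⊗ idm (L1 s p t)) ∘ Phi s s t (esym (comp1m p)) = lunitor (L1 s p t);
  Phi_runit : forall (X Y R B : E) (s : hom R X) (p : hom R B) (t : hom B Y),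
    (idm (L1 s p t) ⊗ Lam t) ∘ Phi s t t (esym (compm1 p)) = runitor (L1 s p t) }.

End GenericStructure.

(* The 2-cell [(s,p,t) -> (s,p1,h);(h,p2,t)] induced by [p = p1;p2] and identities. *)
Definition delta {E : Category} (K : LCC E) {X Y Z R T B : E}
    (s : hom R X) (p1 : hom R T) (h : hom T Y) (p2 : hom T B) (t : hom B Z)
    (p : hom R B) (e : p = p1 ;; p2) :
    hom (polyob K s p t) (polyob K s p1 h ⊙ polyob K h p2 t) :=
  induced K (pcell_id (MkPoly s p1 h)) (pcell_id (MkPoly h p2 t)) e.

(* Main.v *)
From mathcomp Require Import ssreflect ssrfun ssrbool.
From Stdlib Require Import ProofIrrelevance FunctionalExtensionality.
Require Import Defs.

(** A 2-cell from a polynomial [(s,p,t)] into a composite [P;Q] amounts, up to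
    isomorphism of the middle object, to a factorization [p = p1;p2] together with
    2-cells [x] from [(s,p1,h)] to [P] and [y] from [(h,p2,t)] to [Q]; it is then
    [induced x y].  Each composite therefore has
    generic 2-cells into it, the [delta]s, and [induced x y] is [delta] followed by the
    horizontal composite of [x] and [y].

    Consequently the constraints [phi] of an oplax structure (its [oplax_comp]) and a
    generic structure [Phi] determine each other through the single law
      [L (induced x y); phi_(P,Q) = Phi; (L x; L y)].
    From [phi], take [x] and [y] to be identities: [Phi] is forced to be [L delta; phi],
    and the law is naturality of [phi] ([oplax_induced]).  From [Phi], take [x] and [y]
    to be the two parts of the canonical factorization of the middle map of [P;Q]
    through [F x_C D]; they induce the identity, so [phi] is forced to be
    [Phi; (L x; L y)], and the law is naturality of [Phi] ([generic_induced]).  Both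
    round trips are instances of the law.

    The axioms translate one by one, because the bicategory structure of polynomials
    acts on induced cells by manipulating their components: horizontal composition
    postcomposes [x] and [y], the associator rebrackets a factorization into three
    maps, and the unitors are themselves induced by the trivial factorizations [1;p]
    and [p;1].  For associativity of [phi] this requires presenting the identity of
    [P;(Q;R)] as an iterated induced cell, that is, splitting its right-hand component
    a second time.  For units, [1_X] is terminal among polynomials [(h,1,h)], so
    [Lam] amounts to its value at [h = 1]. *)

Set Implicit Arguments.
Unset Strict Implicit.
Unset Printing Implicit Defensive.
Local Open Scope cat_scope.

Lemma oplax_ext (A C : Bicategory) (L : LocalFunctor A C) (w w' : OplaxStructure L) :
  (forall (X Y Z : A) (a : bhom X Y) (b : bhom Y Z), oplax_comp w a b = oplax_comp w' a b) ->
  (forall X : A, oplax_unit w X = oplax_unit w' X) -> w = w'.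
Proof.
case: w => m n a1 a2 a3 a4; case: w' => m' n' a1' a2' a3' a4' /= em en.
have {}em : m = m'.
  by do 5 (apply: functional_extensionality_dep => ?); exact: em.
have {}en : n = n' by apply: functional_extensionality_dep.
subst m' n'; f_equal; exact: proof_irrelevance.
Qed.

(** With [y] an identity, this and the next lemma are functoriality of whiskering. *)
Lemma hcompMl (C : Bicategory) (X Y Z : C) (a a' a'' : bhom X Y) (b b' : bhom Y Z)
    (x : hom a a') (x' : hom a' a'') (y : hom b b') :
  (x ;; x') ⊗ y = (x ⊗ idm b) ;; (x' ⊗ y).
Proof. by rewrite -hcompM comp1m. Qed.

Lemma hcompMr (C : Bicategory) (X Y Z : C) (a a' : bhom X Y) (b b' b'' : bhom Y Z)
    (x : hom a a') (y : hom b b') (y' : hom b' b'') :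
  x ⊗ (y ;; y') = (idm a ⊗ y) ;; (x ⊗ y').
Proof. by rewrite -hcompM comp1m. Qed.

Section Correspondence.
Context {E : Category} (K : LCC E) (C : Bicategory) (L : LocalFunctor (PolyC K) C).

Lemma generic_ext (g g' : GenericStructure L) :
  (forall (X Y Z R T B : E) (s : hom R X) (p1 : hom R T) (h : hom T Y)
      (p2 : hom T B) (t : hom B Z) (p : hom R B) (e : p = p1 ;; p2),
    Phi g s h t e = Phi g' s h t e) ->
  (forall (X T : E) (h : hom T X), Lam g h = Lam g' h) -> g = g'.
Proof.
case: g => m n a1 a2 a3 a4 a5; case: g' => m' n' a1' a2' a3' a4' a5' /= em en.
have {}em : m = m'.
  by do 13 (apply: functional_extensionality_dep => ?); exact: em.
have {}en : n = n' by do 3 (apply: functional_extensionality_dep => ?); exact: en.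
subst m' n'; f_equal; exact: proof_irrelevance.
Qed.

(* Associativity of vertical composition only: an unrestricted rewrite with [compA]
   would also hit the morphisms of [E] on which the constraints depend. *)
Local Notation vcompA := (@compA (bhom (L _) (L _))).

(** The action of [L] on 2-cells, typed by [PCell] instead of the homs of [PolyC K], so
    that the composition laws of polynomial cells are recognized under it. *)
Definition Lcell {X Z : E} {P Q : Poly X Z} (x : PCell P Q) :
  @hom (bhom (L X) (L Z)) (lhom L P) (lhom L Q) := fmap (lhom L) x.

Lemma Lcell_comp (X Z : E) (P Q R : Poly X Z) (x : PCell P Q) (y : PCell Q R) :
  Lcell (pcell_comp x y) = Lcell x ;; Lcell y.
Proof. exact: (fmapM (lhom L)). Qed.

Lemma Lcell_id (X Z : E) (P : Poly X Z) : Lcell (pcell_id P) = idm _.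
Proof. exact: (fmap1 (lhom L)). Qed.

Lemma delta_hcomp (X Y Z S T I : E) (P : Poly X Y) (Q : Poly Y Z)
    (s : hom S X) (p1 : hom S T) (h : hom T Y) (p2 : hom T I) (t : hom I Z)
    (p : hom S I) (e : p = p1 ;; p2)
    (x : PCell (MkPoly s p1 h) P) (y : PCell (MkPoly h p2 t) Q) :
  pcell_comp (delta K s h t e) (pcell_hcomp K x y) = induced K x y e.
Proof. by rewrite pair_hcomp !pcomp1m. Qed.

Section OfOplax.
Context (w : OplaxStructure L).

(** The constraint of [w] with the composite of polynomials visible in its type. *)
Definition oplax_cell {X Y Z : E} (P : Poly X Y) (Q : Poly Y Z) :
    @hom (bhom (L X) (L Z)) (lhom L (pcomp K P Q)) (lhom L P ⊙ lhom L Q) :=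
  @oplax_comp _ _ _ w X Y Z P Q.

Definition oplax_Phi (X Y Z R T B : E) (s : hom R X) (p1 : hom R T) (h : hom T Y)
    (p2 : hom T B) (t : hom B Z) (p : hom R B) (e : p = p1 ;; p2) :
    hom (L1 L s p t) (L1 L s p1 h ⊙ L1 L h p2 t) :=
  Lcell (delta K s h t e) ;; oplax_cell (MkPoly s p1 h) (MkPoly h p2 t).

Definition oplax_Lam (X T : E) (h : hom T X) : hom (L1 L h (idm T) h) (bid (L X)) :=
  Lcell (to_id_cell h) ;; oplax_unit w X.

Lemma oplax_natE (X Y Z : E) (P P' : Poly X Y) (Q Q' : Poly Y Z)
    (x : PCell P P') (y : PCell Q Q') :
  Lcell (pcell_hcomp K x y) ;; oplax_cell P' Q' = oplax_cell P Q ;; (Lcell x ⊗ Lcell y).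
Proof. exact: (oplax_nat w). Qed.

Lemma oplax_assocE (W X Y Z : E) (P : Poly W X) (Q : Poly X Y) (R : Poly Y Z) :
  Lcell (passoc K P Q R) ;; (oplax_cell (pcomp K P Q) R ;; (oplax_cell P Q ⊗ idm _))
  = oplax_cell P (pcomp K Q R) ;; ((idm _ ⊗ oplax_cell Q R) ;; assoc _ _ _).
Proof. exact: (oplax_assoc w). Qed.

(** The law relating [phi] and [Phi], from naturality of [phi]. *)
Lemma oplax_induced (X Y Z S T I : E) (P : Poly X Y) (Q : Poly Y Z)
    (s : hom S X) (p1 : hom S T) (h : hom T Y) (p2 : hom T I) (t : hom I Z)
    (p : hom S I) (e : p = p1 ;; p2)
    (x : PCell (MkPoly s p1 h) P) (y : PCell (MkPoly h p2 t) Q) :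
  Lcell (induced K x y e) ;; oplax_cell P Q = oplax_Phi s h t e ;; (Lcell x ⊗ Lcell y).
Proof. by rewrite -delta_hcomp Lcell_comp -compA oplax_natE compA. Qed.

(** Both sides are [L] of a cell from [(s,a;b;c,t)] to a triple composite, followed by
    constraints of [w]; the two cells correspond under the associator, which turns
    [a;(b;c)] into [(a;b);c]. *)
Lemma oplax_Phi_assoc (W X Y Z F G H B : E)
    (s : hom F W) (a : hom F G) (h : hom G X) (b : hom G H) (k : hom H Y)
    (c : hom H B) (t : hom B Z) :
  assoc (L1 L s a h) (L1 L h b k) (L1 L k c t)
    ∘ (idm (L1 L s a h) ⊗ oplax_Phi h k t (erefl (b ;; c)))
    ∘ oplax_Phi s h t (erefl (a ;; (b ;; c)))
  = (oplax_Phi s h k (erefl (a ;; b)) ⊗ idm (L1 L k c t)) ∘ oplax_Phi s k t (compA a b c).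
Proof.
rewrite hcompMr hcompMl.
rewrite -[X in X ⊗ Lcell (delta K h k t _)]Lcell_id -[X in Lcell (delta K s h k _) ⊗ X]Lcell_id.
rewrite !vcompA -!oplax_induced -!vcompA.
rewrite -oplax_assocE [LHS]vcompA -Lcell_comp; congr (Lcell _ ;; _).
exact: pair_assoc.
Qed.

Definition generic_of_oplax : GenericStructure L.
Proof.
refine {| Phi := oplax_Phi; Lam := oplax_Lam |}.
- move=> X Y Z R S I F T B u q1 k q2 v q eq_q s p1 h p2 t p eq_p f c g Hfg Hfc Hcg.
  rewrite /= -[L2 L Hfc ⊗ _]/(Lcell (Cell Hfc) ⊗ Lcell (Cell Hcg)) -oplax_induced compA.
  rewrite -[L2 L Hfg]/(Lcell (Cell Hfg)) -Lcell_comp; congr (Lcell _ ;; _).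
  by rewrite (pair_pre K eq_q _ _ _ (z1 := Cell Hfc) (z2 := Cell Hcg)) // !pcompm1.
- move=> X R T s t f e; rewrite /= /oplax_Lam compA -[L2 L _]/(Lcell (diag_cell e)) -Lcell_comp.
  by congr (Lcell _ ;; _); exact: to_idpoly_eq.
- exact: oplax_Phi_assoc.
- move=> X Y R B s p t.
  rewrite hcompMl vcompA -Lcell_id -oplax_induced.
  by have /= <- := @oplax_lunit _ _ _ w X Y (MkPoly s p t); rewrite Lcell_id -compA.
move=> X Y R B s p t.
rewrite hcompMr vcompA -Lcell_id -oplax_induced.
by have /= <- := @oplax_runit _ _ _ w X Y (MkPoly s p t); rewrite Lcell_id -compA.
Defined.
End OfOplax.

Section OfGeneric.
Context (g : GenericStructure L).

(** The middle map of [P;Q] is by definition a composite [N -> F x_C D -> D], whose two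
    halves are polynomials over [P] and [Q]. *)
Definition generic_comp {X Y Z : E} (P : Poly X Y) (Q : Poly Y Z) :
    @hom (bhom (L X) (L Z)) (lhom L (pcomp K P Q)) (lhom L P ⊙ lhom L Q) :=
  Phi g (cNE K P Q ;; ps P) (cFDF K P Q ;; ps Q) (cDC K P Q ;; pt Q) erefl
    ;; (Lcell (leftcell K P Q) ⊗ Lcell (rightcell K P Q)).

(** The law relating [phi] and [Phi], from naturality of [Phi]: [induced x y] lies over
    a pair of cells into the two parts of [P;Q]. *)
Lemma generic_induced (X Y Z S T I : E) (P : Poly X Y) (Q : Poly Y Z)
    (s : hom S X) (p1 : hom S T) (h : hom T Y) (p2 : hom T I) (t : hom I Z)
    (p : hom S I) (e : p = p1 ;; p2)
    (x : PCell (MkPoly s p1 h) P) (y : PCell (MkPoly h p2 t) Q) :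
  Lcell (induced K x y e) ;; generic_comp P Q = Phi g s h t e ;; (Lcell x ⊗ Lcell y).
Proof.
have [z1 [z2 [h1 h2 h3 hx hy]]] := pair_split K e x y.
case: (induced K x y e) h1 h3 => f b Hfb /= h1 h3; rewrite -hx -hy !Lcell_comp hcompM !vcompA.
congr (_ ;; _); case: z1 h1 h2 {hx} => f1 c Hfc /= ef ec.
case: z2 ec h3 {hy} => c2 b2 Hcb /= ec eb; subst c2 f1 b2.
exact: (Phi_nat g e erefl Hfb Hfc Hcb).
Qed.

Lemma generic_nat (X Y Z : E) (P P' : Poly X Y) (Q Q' : Poly Y Z)
    (x : PCell P P') (y : PCell Q Q') :
  Lcell (pcell_hcomp K x y) ;; generic_comp P' Q' = generic_comp P Q ;; (Lcell x ⊗ Lcell y).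
Proof. by rewrite generic_induced !Lcell_comp hcompM compA. Qed.

(** Associativity of [phi] after precomposition with the cell induced by a factorization
    into three maps; the law reduces it to associativity of [Phi] on that factorization,
    the three cells [x], [y], [z] being carried along by naturality. *)
Lemma generic_assoc_induced (W X Y Z S T U I : E)
    (P : Poly W X) (Q : Poly X Y) (R : Poly Y Z)
    (s : hom S W) (p1 : hom S T) (h : hom T X) (p2 : hom T U) (k : hom U Y)
    (p3 : hom U I) (t : hom I Z) (p : hom S I) (p23 : hom T I)
    (e : p = p1 ;; p23) (e23 : p23 = p2 ;; p3)
    (x : PCell (MkPoly s p1 h) P) (y : PCell (MkPoly h p2 k) Q) (z : PCell (MkPoly k p3 t) R) :
  let i := induced K x (induced K y z e23) e in
  Lcell (pcell_comp i (passoc K P Q R))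
    ;; (generic_comp (pcomp K P Q) R ;; (generic_comp P Q ⊗ idm _))
  = Lcell i ;; (generic_comp P (pcomp K Q R) ;; ((idm _ ⊗ generic_comp Q R) ;; assoc _ _ _)).
Proof.
move=> i; rewrite {}/i; subst p23 p.
(* [compA p1 p2 p3] makes the factorization proof match the one in [Phi_assoc]. *)
rewrite (pair_assoc K erefl erefl erefl (compA p1 p2 p3)).
rewrite [LHS]vcompA [RHS]vcompA !generic_induced -[LHS]vcompA -[RHS]vcompA.
rewrite (vcompA (_ ⊗ _)) -!hcompM !compm1 !generic_induced.
rewrite hcompMl hcompMr -vcompA assoc_nat !vcompA; congr (_ ;; _).
rewrite -vcompA; exact: esym (Phi_assoc g _ _ _ _ _ _ _).
Qed.

Lemma generic_assoc (W X Y Z : E) (P : Poly W X) (Q : Poly X Y) (R : Poly Y Z) :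
  Lcell (passoc K P Q R) ;; (generic_comp (pcomp K P Q) R ;; (generic_comp P Q ⊗ idm _))
  = generic_comp P (pcomp K Q R) ;; ((idm _ ⊗ generic_comp Q R) ;; assoc _ _ _).
Proof.
(* The identity of [P;(Q;R)] is induced by its two parts, and the right part, a cell
   into [Q;R], is itself induced by a factorization. *)
rewrite -[passoc _ _ _ _]pcomp1m -[RHS]comp1m -[X in _ = X ;; _]Lcell_id pair_id.
case: (split_cell (rightcell K P (pcomp K Q R))) => T p1 h p2 e y z ->.
exact: generic_assoc_induced.
Qed.

Definition oplax_of_generic : OplaxStructure L.
Proof.
refine (@Build_OplaxStructure _ _ L
  (fun X Y Z (P : Poly X Y) (Q : Poly Y Z) => generic_comp P Q)
  (fun X => Lam g (idm X)) _ _ _ _).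
- exact: generic_nat.
- exact: generic_assoc.
- move=> X Y P; rewrite /= compA [X in X ;; _](generic_induced _ (to_id_cell (ps P)) (pcell_id P)).
  rewrite -compA Lcell_id -hcompMl [Lcell _ ;; _](Lam_nat g); exact: Phi_lunit.
move=> X Y P; rewrite /= compA [X in X ;; _](generic_induced _ (pcell_id P) (to_id_cell (pt P))).
rewrite -compA Lcell_id -hcompMr [Lcell _ ;; _](Lam_nat g); exact: Phi_runit.
Defined.
End OfGeneric.

(** The two parts of [P;Q] induce its identity. *)
Lemma generic_of_oplaxK : cancel generic_of_oplax oplax_of_generic.
Proof.
move=> w; apply: oplax_ext => [X Y Z P Q | X] /=.
- by rewrite /generic_comp -oplax_induced -pair_id Lcell_id comp1m.
by rewrite /oplax_Lam (to_idpoly_eq (to_id_cell _) (pcell_id _)) Lcell_id comp1m.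
Qed.

(** The cell [delta] is induced by identities. *)
Lemma oplax_of_genericK : cancel oplax_of_generic generic_of_oplax.
Proof.
move=> g; apply: generic_ext => [X Y Z R T B s p1 h p2 t p e | X T h] /=.
- by rewrite /oplax_Phi generic_induced !Lcell_id hcomp1 compm1.
exact: (Lam_nat g).
Qed.
End Correspondence.

Theorem corollary28 (E : Category) (K : LCC E) (C : Bicategory)
    (L : LocalFunctor (PolyC K) C) :
  exists F : OplaxStructure L -> GenericStructure L,
    bijective F /\
    forall w : OplaxStructure L,
      (forall (X Y Z R T B : E) (s : hom R X) (p1 : hom R T) (h : hom T Y)
          (p2 : hom T B) (t : hom B Z) (p : hom R B) (e : p = p1 ;; p2),
        Phi (F w) s h t e =
        oplax_comp w (polyob K s p1 h) (polyob K h p2 t)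
          ∘ fmap (lhom L) (delta K s h t e)) /\
      (forall (X T : E) (h : hom T X),
        Lam (F w) h =
        oplax_unit w X ∘ L2 L (is_cell_diag (compm1 h))).
Proof.
exists (@generic_of_oplax E K C L); split=> [|w]; last by [].
exists (@oplax_of_generic E K C L); first exact: generic_of_oplaxK.
exact: oplax_of_genericK.
Qed.
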